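(* Let $k$, $d$, and $a$ be positive integers with $k\geq 3$. If $G$ is a $(d+1)$-degenerate graph, then $$\chi'_k(G)\leq 2d+k+a+\frac{d}{a}+1.$$
   Context: All graphs are finite and simple. An $n$-vertex graph is $m$-degenerate if there is an ordering $v_1,\dots,v_n$ of its vertices such that, for every $i$, the number of neighbours of $v_i$ in $\{v_1,\dots,v_{i-1}\}$ is at most $m$. A $\chi'_k$-colouring of a graph $G$ is a colouring of the edges of $G$ (not necessarily proper) such that, for each colour, the subgraph of $G$ formed by the edges of that colour and their endpoints has all vertex degrees congruent to $1 \pmod k$; equivalently, at every vertex, the number of incident edges of each given colour is either $0$ or congruent to $1$ modulo $k$. The mod $k$ chromatic index $\chi'_k(G)$ is the minimum number of colours in a $\chi'_k$-colouring of $G$. Here $d/a$ is the ordinary (real) quotient. *)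

(* Defs.v *)
From mathcomp Require Import all_boot all_order all_algebra.
Set Implicit Arguments.
Unset Strict Implicit.
Unset Printing Implicit Defensive.

Record sgraph := SGraph {
  vertex :> finType;
  adj : rel vertex;
  adj_sym : symmetric adj;
  adj_irrefl : irreflexive adj }.

Section Graph.
Variable G : sgraph.

Definition neighbours (x : G) : {set G} := [set y | adj x y].

Definition edges : {set {set G}} := [set [set p.1; p.2] | p : G * G & adj p.1 p.2].

Definition edge := {E : {set G} | E \in edges}.

Definition degenerate (m : nat) : Prop :=
  exists2 v : 'I_#|G| -> G, bijective v &
    forall i : 'I_#|G|,
      #|neighbours (v i) :&: [set v j | j : 'I_#|G| & j < i]| <= m.

Definition colour_degree (q : nat) (c : edge -> 'I_q) (i : 'I_q) (x : G) : nat :=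
  #|[set E : edge | (x \in val E) && (c E == i)]|.

(* A vertex belongs to the subgraph formed by the edges of colour i and their
   endpoints exactly when its degree in colour i is nonzero. *)
Definition mod_colouring (k q : nat) (c : edge -> 'I_q) : bool :=
  [forall i : 'I_q, forall x : G,
    (colour_degree c i x != 0) ==> (colour_degree c i x == 1 %[mod k])].

Definition mod_colourable (k q : nat) : bool :=
  [exists c : {ffun edge -> 'I_q}, mod_colouring k c].

Lemma mod_colourable_exists (k : nat) : exists q, mod_colourable k q.
Proof.
exists #|{: edge}|; apply/existsP; exists [ffun E => enum_rank E].
apply/forallP=> i; apply/forallP=> x; apply/implyP; rewrite -lt0n => d_gt0.
suff -> : colour_degree [ffun E => enum_rank E] i x = 1 by [].
apply/eqP; rewrite eqn_leq d_gt0 andbT -(cards1 (enum_val i)).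
apply/subset_leq_card/subsetP=> E; rewrite !inE ffunE => /andP[_ /eqP <-].
by rewrite enum_rankK.
Qed.

Definition mod_chromatic_index (k : nat) : nat :=
  ex_minn (mod_colourable_exists k).

End Graph.

(* Main.v *)
Require Import Defs.
From mathcomp Require Import all_boot all_order all_algebra.
From mathcomp Require Import zify.
Import Order.TTheory GRing.Theory Num.Theory.

(** Order the vertices so that each has at most [d + 1] earlier neighbours, and
    let [q = 2 d + k + a + e + 1] with [e] the integer part of [d / a].  The
    vertices are visited in this order; a visit to [v] colours all edges from
    [v] to later vertices at once.  Besides the degree condition at visited
    vertices, the invariant is that the edges from any vertex back to visited
    ones have distinct colours ([partial_mod_colouring]).  Hence, when [v] is
    visited, each of its at most [d + 1] back colours, forming a set [B], occurs
    exactly once at [v], and a later neighbour [w] of [v] forbids at most [d]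
    colours [F w].  It remains to colour the later neighbours [U] of [v], each
    [w] outside [F w], so that the classes have size [0 %[mod k]] for colours in
    [B], and size [0] or [1 %[mod k]] for the others; this is [completable], and
    it is solved by [completable_star] in three stages.

    - Fix a set [S] of [d + a] colours containing [B].  Greedily assign to
      colours of [S] blocks of [k] vertices (or one vertex, when the colour is
      still unused at [v]).  When this stops, every colour of [S] is allowed for
      at most [k - 1] of the remaining vertices, while every vertex allows at
      least [a] colours of [S].  Double counting shows that at most
      [(k - 1) (d + a) / a] vertices remain ([completable_bulk]).
    - Every remaining vertex allows at least [q - (d + a) - d = k + e + 1] of the
      unused colours.  As long as some unused colour is allowed for [k + 1]
      remaining vertices, give it to [k + 1] of them ([completable_fresh]).  The
      bound on the number of remaining vertices makes this happen at most
      [e + 1] times, so that at least [k] allowed unused colours are left for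
      each vertex.
    - Now every remaining vertex allows at least [k] unused colours and every
      unused colour is allowed for at most [k] vertices, so Hall's theorem gives
      the remaining vertices distinct unused colours ([completable_rainbow]). *)

Set Implicit Arguments.
Unset Strict Implicit.
Unset Printing Implicit Defensive.

(** * Counting, and systems of distinct representatives *)

Lemma sum_card_incidence (T C : finType) (X : {set T}) (Y : {set C})
    (N : T -> {set C}) :
  \sum_(x in X) #|Y :&: N x| = \sum_(c in Y) #|[set x in X | c \in N x]|.
Proof.
under eq_bigr => x _ do rewrite -sum1_card big_mkcond /=.
under [RHS]eq_bigr => c _ do rewrite -sum1_card big_mkcond /=.
rewrite [RHS]big_mkcond [LHS]big_mkcond /=.
transitivity (\sum_x \sum_c ([&& x \in X, c \in Y & c \in N x] : nat)).
  apply: eq_bigr => x _; case: ifP => xX; last by rewrite big1.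
  by apply: eq_bigr => c _; rewrite inE /=; case: ifP.
rewrite exchange_big; apply: eq_bigr => c _; case: ifP => cY.
  by apply: eq_bigr => x _; rewrite inE /=; case: ifP.
by rewrite big1 // => x _; rewrite andbF.
Qed.

Lemma subset_of_card (T : finType) (A : {set T}) n :
  n <= #|A| -> exists2 K : {set T}, K \subset A & #|K| = n.
Proof.
rewrite -bin_gt0 -(cards_draws A n) card_gt0 => /set0Pn[K].
by rewrite inE => /andP[KA /eqP]; exists K.
Qed.

Lemma superset_of_card (T : finType) (A : {set T}) n :
  #|A| <= n <= #|T| -> exists2 K : {set T}, A \subset K & #|K| = n.
Proof.
case/andP=> An nT; have [|K KA Kn] := @subset_of_card T (~: A) (n - #|A|).
  by have := cardsC A; lia.
exists (A :|: K); first exact: subsetUl.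
rewrite cardsU Kn (_ : A :&: K = set0) ?cards0; first by lia.
by apply/setP=> x; rewrite !inE; apply/negP=> /andP[xA /(subsetP KA)]; rewrite inE xA.
Qed.

Definition representable (T C : finType) (U : {set T}) (N : T -> {set C}) :=
  exists2 g : T -> C, {in U &, injective g} & forall u, u \in U -> g u \in N u.

(** Hall's marriage theorem, by the Halmos-Vaughan induction: if some proper
    nonempty [X] is tight, represent [X] and then its complement with the
    neighbours of [X] removed; otherwise any vertex can be given any of its
    neighbours, because deleting one colour keeps Hall's condition.  The colour
    [c0] only provides a value outside [U]. *)
Lemma hall (T C : finType) (c0 : C) (U : {set T}) (N : T -> {set C}) :
  (forall X : {set T}, X \subset U -> #|X| <= #|\bigcup_(x in X) N x|) ->
  representable U N.
Proof.
have [n] := ubnP #|U|; elim: n U N => // n IH U N Un hN.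
have [->|[u uU]] := set_0Vmem U.
  by exists (fun=> c0) => [u v|u]; rewrite inE.
have [/existsP[X /and4P[XU X0 XnU /eqP tight]]|/existsPn loose] :=
    boolP [exists X : {set T}, [&& X \subset U, X != set0, X != U
                                 & #|\bigcup_(x in X) N x| == #|X| ]].
  have XltU : #|X| < #|U| by apply/proper_card; rewrite properEneq XnU.
  have [|Y YX|g ginj gN] := IH X N; first by lia.
    by apply: hN; apply: subset_trans YX XU.
  set D := \bigcup_(x in X) N x in tight.
  have [||h hinj hN'] := IH (U :\: X) (fun x => N x :\: D).
  - by move: X0; rewrite -card_gt0 cardsD (setIidPr XU); lia.
  - move=> Y; rewrite subsetD => /andP[YU dYX].
    have := hN (X :|: Y); rewrite subUset XU YU => /(_ isT).
    rewrite bigcup_setU -/D cardsU (_ : X :&: Y = set0); last first.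
      by apply/eqP; rewrite setI_eq0 disjoint_sym.
    have -> : \bigcup_(x in Y) (N x :\: D) = (\bigcup_(x in Y) N x) :\: D.
      apply/setP=> c; rewrite inE; apply/bigcupP/andP.
        by case=> y yY; rewrite inE => /andP[-> cN]; split=> //; apply/bigcupP; exists y.
      by case=> cD /bigcupP[y yY cN]; exists y => //; rewrite inE cD.
    by rewrite cards0 cardsU cardsD setIC; lia.
  exists (fun x => if x \in X then g x else h x).
    have sep x y : x \in X -> y \in U -> y \notin X -> g x <> h y.
      move=> xX yU yX e; have := hN' y; rewrite !inE yU yX => /(_ isT).
      by rewrite -e => /andP[/negP[]]; apply/bigcupP; exists x => //; apply: gN.
    move=> x y xU yU /=; case: ifPn => xX; case: ifPn => yX.
    - exact: ginj.
    - by move/(sep _ _ xX yU yX).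
    - by move/esym/(sep _ _ yX xU xX).
    - by apply: hinj; rewrite inE ?xX ?yX.
  move=> x xU /=; case: ifPn => xX; first exact: gN.
  by have := hN' x; rewrite inE xX xU => /(_ isT); rewrite inE => /andP[].
have [c cNu] : exists c, c \in N u.
  apply/set0Pn; rewrite -card_gt0; have := hN [set u].
  by rewrite sub1set uU cards1 big_set1 => /(_ isT).
have [||g ginj gN] := IH (U :\ u) (fun x => N x :\ c).
- by move: Un; rewrite (cardsD1 u U) uU; lia.
- move=> Y; rewrite subsetD1 => /andP[YU uY].
  have [->|[y yY]] := set_0Vmem Y; first by rewrite cards0.
  have := loose Y; rewrite YU /=.
  have -> : Y != set0 by apply/set0Pn; exists y.
  have -> /= : Y != U by apply: contraNneq uY => ->.
  have -> : \bigcup_(x in Y) (N x :\ c) = (\bigcup_(x in Y) N x) :\ c.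
    apply/setP=> c'; rewrite !inE; apply/bigcupP/andP.
      by case=> z zY; rewrite !inE => /andP[-> cN]; split=> //; apply/bigcupP; exists z.
    by case=> cD /bigcupP[z zY cN]; exists z => //; rewrite !inE cD.
  have := hN _ YU.
  by rewrite [in X in X -> _](cardsD1 c) [in X in _ -> X -> _](cardsD1 c); lia.
exists (fun x => if x == u then c else g x).
  have sep y : y \in U -> y != u -> c <> g y.
    by move=> yU yu e; have := gN y; rewrite !inE yU yu -e eqxx => /(_ isT).
  move=> x y xU yU /=; case: eqVneq => [->|xu]; case: eqVneq => [->|yu] //.
  - by move/(sep _ yU yu).
  - by move/esym/(sep _ xU xu).
  - by apply: ginj; rewrite !inE ?xu ?yu.
move=> x xU /=; case: eqVneq => [->|xu] //.
by have := gN x; rewrite !inE xu xU => /(_ isT) /andP[].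
Qed.

(** Counting the incidences between [X] and its neighbourhood [D] gives
    [k * #|X| <= k * #|D|], which is Hall's condition. *)
Lemma representable_degree (T C : finType) (c0 : C) (U : {set T})
    (N : T -> {set C}) k :
  0 < k -> (forall u, u \in U -> k <= #|N u|) ->
  (forall c, #|[set u in U | c \in N u]| <= k) -> representable U N.
Proof.
move=> k0 lo hi; apply: hall => // X XU; set D := \bigcup_(x in X) N x.
rewrite -(leq_pmul2r k0) -!sum_nat_const.
apply: (@leq_trans (\sum_(x in X) #|D :&: N x|)).
  apply: leq_sum => x xX; rewrite (setIidPr _) ?lo ?(subsetP XU) //.
  exact: bigcup_sup.
rewrite sum_card_incidence; apply: leq_sum => c _; apply: leq_trans (hi c).
by apply: subset_leq_card; apply/subsetP=> x; rewrite !inE => /andP[/(subsetP XU)->].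
Qed.

(** * Colouring the edges from one vertex to the later ones *)

(** A colour in [B] is one whose present multiplicity at the vertex is already
    [1] modulo [k]; any other colour is still absent there.  The predicate says
    that [n] further edges of colour [c] keep the vertex legal. *)
Definition good_multiplicity (C : finType) k (B : {set C}) (c : C) (n : nat) :=
  if c \in B then k %| n else (n == 0) || (n == 1 %[mod k]).

Definition completable (T C : finType) k (F : T -> {set C})
    (U : {set T}) (B : {set C}) :=
  exists2 g : T -> C, forall u, u \in U -> g u \notin F u &
    forall c, good_multiplicity k B c #|[set u in U | g u == c]|.

(** One greedy step.  A block of [k] (if [c] is already present) or of
    [1 %[mod k]] elements (if it is absent) makes [c] present with multiplicity
    [1] modulo [k], so the rest may be coloured with [c |: B] in place of [B]. *)
Lemma completable_block (T C : finType) k (F : T -> {set C}) (U K : {set T})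
    (B : {set C}) (c : C) :
  K \subset U -> (forall u, u \in K -> c \notin F u) ->
  #|K| = (c \notin B) %[mod k] ->
  completable k F (U :\: K) (c |: B) -> completable k F U B.
Proof.
move=> KU Kc Kk [g gF gk]; exists (fun u => if u \in K then c else g u).
  move=> u uU /=; case: ifPn => uK; first exact: Kc.
  by apply: gF; rewrite inE uK.
move=> c'; have := gk c'; rewrite /good_multiplicity !inE.
set P := [set _ in _ | _]; set Q := [set _ in _ | _].
case: (eqVneq c' c) => [e|c'c]; last first.
  suff -> : P = Q by [].
  apply/setP=> u; rewrite !inE; case: ifPn => uK //=.
  by rewrite eq_sym (negPf c'c) andbF.
have -> : Q = K :|: P.
  apply/setP=> u; rewrite !inE e; case: (boolP (u \in K)) => uK //=.
  by rewrite (subsetP KU) //= eqxx.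
rewrite cardsU (_ : K :&: P = set0) ?cards0 ?subn0; last first.
  by apply/setP=> u; rewrite !inE; case: (u \in K).
move=> /= /eqP kP; rewrite e; move: Kk; case: (c \in B) => /= Kk.
  by rewrite /dvdn -modnDm Kk kP !mod0n.
by apply/orP; right; rewrite -modnDm Kk kP addn0 modn_mod.
Qed.

(** Blocks in colours of [S] can be split off until each colour of [S] has fewer
    than [k] takers: [k] takers give a block of size [k] or, for an absent
    colour, of size [1]. *)
Lemma completable_bulk (T C : finType) k (F : T -> {set C}) (S : {set C})
    (U : {set T}) (B : {set C}) :
  0 < k -> B \subset S ->
  (forall (R : {set T}) (B' : {set C}), B' \subset S -> R \subset U ->
     (forall c, c \in S -> #|[set u in R | c \notin F u]| < k) ->
     completable k F R B') ->
  completable k F U B.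
Proof.
move=> k0 BS base.
have [n] := ubnP #|U|; elim: n U B BS base => // n IH U B BS base Un.
set A := fun c => [set u in U | c \notin F u].
have AU c : A c \subset U by apply/subsetP=> u; rewrite inE => /andP[].
have block (c : C) (K : {set T}) : K \subset A c -> 0 < #|K| ->
    #|K| = (c \notin B) %[mod k] -> c \in S -> completable k F U B.
  move=> KA K0 Kk cS; apply: (@completable_block _ _ _ _ _ K _ c) => //.
  - exact: subset_trans KA (AU c).
  - by move=> u /(subsetP KA); rewrite inE => /andP[].
  - apply: IH; first by rewrite subUset sub1set cS.
      by move=> R B' B'S RU; apply: base => //; apply: subset_trans RU (subsetDl _ _).
    rewrite cardsD (setIidPr (subset_trans KA (AU c))).
    by have := subset_leq_card (subset_trans KA (AU c)); lia.
have [/existsP[c /andP[cS big]]|/existsPn small] :=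
    boolP [exists c, (c \in S) && (k <= #|A c|)].
  have [cB|cB] := boolP (c \in B).
    have [K KA Kk] := subset_of_card big.
    by apply: (block c K) => //; rewrite ?Kk // cB modnn mod0n.
  have [K KA K1] := @subset_of_card _ (A c) 1 (leq_trans k0 big).
  by apply: (block c K) => //; rewrite K1 ?cB.
by apply: base => // c cS; have := small c; rewrite cS /= -ltnNge.
Qed.

(** Giving pairwise distinct absent colours is always legal; the degree
    conditions make it possible. *)
Lemma completable_rainbow (T C : finType) (c0 : C) k (F : T -> {set C})
    (U : {set T}) (B : {set C}) :
  0 < k -> (forall u, u \in U -> k <= #|~: B :\: F u|) ->
  (forall c, ~~ (k < #|[set u in U | c \in ~: B :\: F u]|)) ->
  completable k F U B.
Proof.
move=> k0 lists small.
have [c|g ginj gN] := @representable_degree _ _ c0 U (fun u => ~: B :\: F u) k k0 lists.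
  by rewrite leqNgt.
exists g => [u /gN|c]; first by rewrite inE => /andP[].
rewrite /good_multiplicity; set P := [set _ in _ | _].
have [->|[u]] := set_0Vmem P; first by rewrite cards0 dvdn0; case: ifP.
rewrite inE => /andP[uU /eqP gu].
have -> : P = [set u].
  apply/setP=> x; rewrite !inE; apply/andP/eqP => [[xU /eqP gx]|->].
    by apply: ginj => //; rewrite gx.
  by rewrite gu.
have := gN u uU; rewrite gu !inE => /andP[_ /negPf->].
by rewrite cards1 eqxx.
Qed.

(** As long as an absent colour has [k + 1] takers it is spent on [k + 1] of
    them, which lowers [n] by one; when there is none,
    [completable_rainbow] finishes.  At [n = 0] fewer than [k + 1] elements are
    left, so the process has stopped by then. *)
Lemma completable_fresh (T C : finType) (c0 : C) k (F : T -> {set C}) n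
    (U : {set T}) (B : {set C}) :
  0 < k -> (forall u, u \in U -> k + n <= #|~: B :\: F u|) ->
  #|U| <= k.+1 * n + k -> completable k F U B.
Proof.
move=> k0; elim: n U B => [|n IH] U B lists Un;
  pose A c := [set u in U | c \in ~: B :\: F u];
  (have AU c : A c \subset U by apply/subsetP=> u; rewrite inE => /andP[]);
  have [/existsP[c big]|/existsPn small] := boolP [exists c, k < #|A c|].
- by have := subset_leq_card (AU c); lia.
- by apply: completable_rainbow small => // u /lists; rewrite addn0.
- have [K KA Kk] := subset_of_card big.
  have KU := subset_trans KA (AU c).
  have cK u : u \in K -> (c \notin B) && (c \notin F u).
    by move/(subsetP KA); rewrite !inE => /and3P[_ -> ->].
  have [u uK] : exists u, u \in K by apply/set0Pn; rewrite -card_gt0 Kk.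
  have cB : c \notin B by case/andP: (cK u uK).
  apply: (@completable_block _ _ _ _ _ K _ c) => //.
  + by move=> w /cK/andP[].
  + by rewrite Kk cB -addn1 modnDl.
  + apply: IH; last by rewrite cardsD (setIidPr KU) Kk; lia.
    move=> w; rewrite inE => /andP[_ /lists].
    rewrite (cardsD1 c) addnS => h.
    have -> : ~: (c |: B) :\: F w = (~: B :\: F w) :\ c.
      by apply/setP=> x; rewrite !inE negb_or; do !case: (_ \in _); case: (_ == _).
    by move: h; case: (_ \in _) => /=; lia.
- by apply: completable_rainbow small => // u /lists; lia.
Qed.

(** The set [S] below has [d + a] colours: this is large enough to contain [B],
    it leaves every element of [U] at least [a] allowed colours in [S], and small
    enough that every element keeps [k + d %/ a + 1] allowed colours
    outside [S]. *)
Lemma completable_star (T C : finType) (c0 : C) (k d a : nat)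
    (F : T -> {set C}) (U : {set T}) (B : {set C}) :
  0 < k -> 0 < a -> #|B| <= d + 1 -> (forall u, u \in U -> #|F u| <= d) ->
  2 * d + k + a + d %/ a + 1 <= #|C| -> completable k F U B.
Proof.
move=> k0 a0 Bd Fd; have := ltn_ceil d a0; move: (d %/ a) => e de Cq.
have [|S BS Scard] := @superset_of_card _ B (d + a); first by lia.
suff base (R : {set T}) (B' : {set C}) : B' \subset S -> R \subset U ->
    (forall c, c \in S -> #|[set u in R | c \notin F u]| < k) ->
    completable k F R B' by exact: completable_bulk base.
move=> B'S RU few.
have FR u : u \in R -> #|F u| <= d by move/(subsetP RU)/Fd.
apply: (@completable_fresh _ _ c0 _ _ e.+1) => // [u uR|].
  have := FR u uR; have := subset_leq_card B'S.
  have := cardsC B'; have := cardsD (~: B') (F u).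
  have := subset_leq_card (subsetIr (~: B') (F u)); lia.
(* Double counting of the pairs (u, c) with u in R and c in S allowed for u. *)
have Ra : #|R| * a <= (d + a) * k.-1.
  rewrite -sum_nat_const -Scard -[X in _ <= X]sum_nat_const.
  apply: (@leq_trans (\sum_(u in R) #|S :&: ~: F u|)).
    apply: leq_sum => u /FR Fu; rewrite -setDE cardsD Scard.
    by have := subset_leq_card (subsetIr S (F u)); lia.
  rewrite (@sum_card_incidence _ _ R S (fun u => ~: F u)).
  apply: leq_sum => c /few; under eq_finset do rewrite -in_setC.
  by rewrite -(ltn_predK k0) ltnS.
(* Since d < (e + 1) a, at most (k - 1) (e + 2) elements remain, which is at
   most (k + 1) (e + 1) + k. *)
rewrite -(leq_pmul2r a0); apply: leq_trans Ra _.
have da : d + a <= e.+2 * a by rewrite mulSn addnC leq_add2l ltnW.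
apply: leq_trans (leq_mul da (leqnn _)) _.
by rewrite mulnAC leq_pmul2r //; nia.
Qed.

(** * From stars to degenerate graphs *)

Lemma edge_colouring_of_sym (G : sgraph) q (f : G -> G -> 'I_q) :
  (forall x y, f x y = f y x) ->
  exists c : edge G -> 'I_q, forall i x,
    colour_degree c i x = #|[set y in neighbours x | f x y == i]|.
Proof.
move=> fC.
have ends (E : edge G) :
    exists p : G * G, adj p.1 p.2 && (val E == [set p.1; p.2]).
  by have /imsetP[p] := valP E; rewrite inE => pE eE; exists p; rewrite pE eE /=.
have [p pE] := fin_all_exists ends; pose c E := f (p E).1 (p E).2.
have cE (E : edge G) x y : val E = [set x; y] -> c E = f x y.
  rewrite /c; have /andP[+ /eqP->] := pE E; case: (p E) => p1 p2 /= p12E e.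
  have p12 : p1 != p2 by apply: contraTneq p12E => ->; rewrite adj_irrefl.
  have := set21 p1 p2; have := set22 p1 p2; rewrite e !inE.
  by case/orP=> /eqP e2; case/orP=> /eqP e1; move: p12; rewrite e1 e2 ?eqxx.
exists c => i x; rewrite /colour_degree -(card_imset _ val_inj).
rewrite -[RHS](@card_in_imset _ _ (fun y => [set x; y])); last first.
  move=> y z; rewrite !inE => /andP[xy _] _ e.
  have := set22 x y; rewrite e !inE => /orP[/eqP yx|/eqP //].
  by move: xy; rewrite yx adj_irrefl.
congr #|pred_of_set _|; apply/setP=> D; apply/imsetP/imsetP.
  case=> E; rewrite inE => /andP[xE /eqP <-] ->.
  have /andP[+ /eqP eE] := pE E; move: eE; case: (p E) => p1 p2 eE p12E.
  move: xE; rewrite eE !inE => /orP[] /eqP ->.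
    by exists p2 => //; rewrite !inE p12E (cE _ _ _ eE) eqxx.
  exists p1; last by rewrite setUC.
  by rewrite !inE adj_sym p12E (cE _ _ _ eE) fC eqxx.
case=> y; rewrite !inE => /andP[xy /eqP fi] ->.
have xyE : [set x; y] \in edges G by apply/imsetP; exists (x, y); rewrite ?inE.
pose E : edge G := exist (fun D => D \in edges G) [set x; y] xyE.
by exists E; rewrite // inE (cE E x y) // fi eqxx andbT set21.
Qed.

(** Edges are coloured through symmetric functions on pairs of vertices; at stage
    [m] only the values on edges with an end at position less than [m] matter.
    Distinctness of the colours of edges towards earlier vertices is what turns
    the present colours of the next vertex into a set of simple multiplicities,
    and bounds the colours forbidden by its later neighbours.  Taking [set0] as
    the set of present colours, [good_multiplicity] is the plain requirement
    that the multiplicity be [0] or [1 %[mod k]]. *)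
Definition partial_mod_colouring (G : sgraph) (C : finType) (pos : G -> nat) k m
    (f : G -> G -> C) :=
  [/\ forall x y, f x y = f y x,
      forall w x y, adj w x -> adj w y -> pos x < pos w -> pos y < pos w ->
        pos x < m -> pos y < m -> f w x = f w y -> x = y
    & forall v c, pos v < m ->
        good_multiplicity k set0 c #|[set y in neighbours v | f v y == c]|].

(** Visiting the vertex [v] at position [m].  A later neighbour [w] of [v] has at
    most [d] earlier neighbours besides [v], hence the bound [d], and not
    [d + 1], on the colours that [w] forbids.  Only edges from [v] to later
    vertices are recoloured, so visited vertices are not affected. *)
Lemma partial_mod_colouringS (G : sgraph) (C : finType) (c0 : C) (pos : G -> nat)
    k d a m (f : G -> G -> C) :
  injective pos -> 0 < k -> 0 < a ->
  (forall x, #|[set y in neighbours x | pos y < pos x]| <= d + 1) ->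
  2 * d + k + a + d %/ a + 1 <= #|C| ->
  partial_mod_colouring pos k m f ->
  exists f' : G -> G -> C, partial_mod_colouring pos k m.+1 f'.
Proof.
move=> pos_inj k0 a0 back Cq [fC fback fgood].
have ltS x : (pos x < m.+1) = (pos x == m) || (pos x < m) by rewrite ltnS leq_eqVlt.
have [/existsP[v /eqP vm]|/existsPn nov] := boolP [exists v, pos v == m]; last first.
  exists f; split=> //.
    by move=> w x y wx wy xw yw; rewrite !ltS !(negPf (nov _)); apply: fback.
  by move=> v c; rewrite ltS (negPf (nov v)); apply: fgood.
have ltSv x : (pos x < m.+1) = (x == v) || (pos x < m).
  by rewrite ltS -vm (inj_eq pos_inj).
pose W := [set w in neighbours v | m < pos w].
pose V := [set x in neighbours v | pos x < m].
pose F w := [set f w x | x in [set x in neighbours w | pos x < m]].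
have [||g gF gk] := @completable_star _ C c0 k d a F W [set f v x | x in V] k0 a0 _ _ Cq.
- by apply: leq_trans (leq_imset_card _ _) _; rewrite /V -vm.
- move=> w; rewrite !inE => /andP[vw mw]; apply: leq_trans (leq_imset_card _ _) _.
  have := back w; rewrite (cardsD1 v) !inE adj_sym vw vm mw addnC leq_add2r.
  apply: leq_trans; apply: subset_leq_card; apply/subsetP=> x; rewrite !inE.
  case/andP=> -> xm; rewrite (ltn_trans xm mw) !andbT.
  by apply: contraTneq xm => ->; rewrite vm ltnn.
pose f' x y :=
  if (x == v) && (y \in W) then g y else if (y == v) && (x \in W) then g x else f x y.
have f'C x y : f' x y = f' y x.
  rewrite /f'; case: (eqVneq x v) => [->|_]; case: (eqVneq y v) => [->|_] //=.
    by case: ifP => // _; apply: fC.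
  by case: ifP => // _; apply: fC.
have f'W w : w \in W -> f' v w = g w by rewrite /f' eqxx => ->.
have f'f x y : pos x <= m -> pos y <= m -> f' x y = f x y.
  by move=> xm ym; rewrite /f' !inE ![m < _]ltnNge xm ym /= !andbF.
have f'old x y : pos x < m -> f' x y = f x y.
  move=> xm; rewrite /f' !inE [m < pos x]ltnNge (ltnW xm) /= !andbF.
  by case: eqVneq xm => [->|//]; rewrite vm ltnn.
exists f'; split=> //.
(* With y not after x, the only new case is x = v and y visited: then g w avoids
   the colour of the edge from w to y. *)
- move=> w x y; wlog xy : x y / pos y <= pos x.
    move=> H wx wy xw yw xm ym e; case: (leqP (pos y) (pos x)) => [yx|/ltnW xy].
      exact: H.
    by apply/esym; apply: H.
  move=> wx wy xw yw; rewrite !ltSv => /orP[/eqP xv|xm] ym; last first.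
    rewrite (f'C w) (f'C w y) !f'old ?(leq_ltn_trans xy) // (fC x) (fC y).
    by apply: fback; rewrite // (leq_ltn_trans xy).
  case/orP: ym => [/eqP->|ym]; rewrite xv //.
  have wW : w \in W by rewrite !inE adj_sym -xv wx -vm -xv xw.
  rewrite (f'C w) f'W // (f'C w) f'old // (fC y) => e.
  have := gF w wW; rewrite e => /negP[]; apply/imsetP; exists y => //.
  by rewrite !inE wy.
move=> u c; rewrite ltSv => /orP[/eqP->|um]; last first.
  rewrite (_ : [set _ in _ | _] = [set y in neighbours u | f u y == c]) ?fgood //.
  by apply/setP=> y; rewrite !inE f'old.
(* Vc and Wc are the edges of colour c at v towards earlier and later vertices;
   #|Vc| is 1 or 0 according to whether c is a colour already present at v. *)
have := gk c; rewrite /good_multiplicity [_ \in set0]inE.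
set Wc := [set _ in W | _].
pose Vc := [set x in V | f v x == c].
have -> : [set y in neighbours v | f' v y == c] = Vc :|: Wc.
  apply/setP=> y; rewrite !inE; case vy : (adj v y) => //=.
  case: ltngtP => [ym|my|ym] /=.
  - by rewrite (f'f v y) ?vm ?(ltnW ym) // orbF.
  - by rewrite f'W // !inE vy.
  - by move: vy; rewrite -vm in ym; rewrite (pos_inj _ _ ym) adj_irrefl.
rewrite cardsU (_ : Vc :&: Wc = set0) ?cards0 ?subn0; last first.
  by apply/setP=> y; rewrite !inE; case: ltngtP; rewrite ?andbF.
case: ifPn => [/imsetP[x xV cE]|cV].
  have -> : Vc = [set x].
    apply/setP=> y; rewrite !inE; move: xV; rewrite !inE => /andP[vx xm].
    apply/andP/eqP => [[/andP[vy ym] /eqP e]|->]; last by rewrite vx xm cE.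
    by apply: (fback v) => //; rewrite ?vm // e.
  by rewrite cards1 => /dvdnP[r ->]; rewrite addnC modnMDl eqxx orbT.
suff -> : Vc = set0 by rewrite cards0.
apply/setP=> x; rewrite !inE; apply: contraNF cV => /andP[xV /eqP <-].
by apply/imsetP; exists x => //; rewrite !inE.
Qed.

Lemma degenerate_mod_colourable (G : sgraph) k d a :
  0 < k -> 0 < a -> degenerate G (d + 1) ->
  mod_colourable G k (2 * d + k + a + d %/ a + 1).
Proof.
move=> k0 a0 [v [v' vK v'K] back].
set q := _ + 1; have c0 : 'I_q by rewrite /q addn1; exact: ord0.
pose pos x : nat := v' x.
have pos_inj : injective pos by move=> x y /ord_inj/(can_inj v'K).
have backP x : #|[set y in neighbours x | pos y < pos x]| <= d + 1.
  apply: leq_trans (back (v' x)); rewrite v'K; apply: subset_leq_card.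
  apply/subsetP=> y; rewrite !inE => /andP[-> yx]; apply/imsetP.
  by exists (v' y); rewrite ?inE ?v'K.
have [f [fC _ fgood]] : exists f : G -> G -> 'I_q, partial_mod_colouring pos k #|G| f.
  elim: #|G| => [|m [f]]; first by exists (fun _ _ => c0).
  by apply: (@partial_mod_colouringS _ _ c0 _ _ d a); rewrite ?card_ord.
have [c cE] := edge_colouring_of_sym fC.
apply/existsP; exists [ffun E => c E]; apply/forallP=> i; apply/forallP=> x.
have -> : colour_degree [ffun E => c E] i x = colour_degree c i x.
  by apply: eq_card => E; rewrite !inE ffunE.
rewrite cE; have := fgood x i (ltn_ord _).
by rewrite /good_multiplicity inE implyNb.
Qed.

Unset Implicit Arguments.

Theorem lemma9 (R : realFieldType) (k d a : nat) (G : sgraph) :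
  0 < k -> 0 < d -> 0 < a -> 3 <= k ->
  degenerate G (d + 1) ->
  ((mod_chromatic_index G k)%:R
     <= 2%:R * d%:R + k%:R + a%:R + d%:R / a%:R + 1 :> R)%R.
Proof.
move=> k0 _ a0 _ Gd.
have colG := degenerate_mod_colourable k0 a0 Gd.
have le_q : mod_chromatic_index G k <= 2 * d + k + a + d %/ a + 1.
  by rewrite /mod_chromatic_index; case: ex_minnP => q _; apply.
apply: (@le_trans _ _ (2 * d + k + a + d %/ a + 1)%:R%R); first by rewrite ler_nat.
rewrite 4!natrD natrM !lerD // ler_pdivlMr ?ltr0n // -natrM ler_nat.
exact: leq_trunc_div.
Qed.
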